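(* For every $\varepsilon>0$ there exist $m,n\ge1$, $A,D\in\mathbb{R}^{m\times n}$, $\mathbf{b}\in\mathbb{R}^m$, $\mathbf{c},\boldsymbol{\varphi}\in\mathbb{R}^n$ and an interval $\Lambda\subseteq\mathbb{R}$ such that for every $\lambda\in\Lambda$ the linear program $f_A(\lambda)=\min\{\mathbf{c}^t\mathbf{x}: (A+\lambda D)\mathbf{x}\le\mathbf{b},\ \mathbf{x}\ge0\}$ is feasible with finite optimal value, the minimum $$g_A^\varepsilon(\lambda)=\min\{\boldsymbol{\varphi}^t\mathbf{x}\ :\ \mathbf{c}^t\mathbf{x}\le f_A(\lambda)+\varepsilon,\ (A+\lambda D)\mathbf{x}\le\mathbf{b},\ \mathbf{x}\ge0\}$$ is finite for every $\lambda\in\Lambda$, and the function $g_A^\varepsilon:\Lambda\to\mathbb{R}$ is not continuous.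
   Context: Vector inequalities are componentwise. *)

(* Defs.v *)
From HB Require Import structures.
From mathcomp Require Import all_boot all_order all_algebra.
From mathcomp Require Import all_classical all_reals all_analysis.

Set Implicit Arguments.
Unset Strict Implicit.
Unset Printing Implicit Defensive.

Import Order.TTheory GRing.Theory Num.Theory.
Import numFieldNormedType.Exports.

Local Open Scope classical_set_scope.
Local Open Scope ring_scope.

Definition cvle (R : realType) (k : nat) (u v : 'cV[R]_k) : Prop :=
  forall i : 'I_k, u i 0 <= v i 0.

Definition dotp (R : realType) (n : nat) (c x : 'cV[R]_n) : R :=
  (c^T *m x) 0 0.

Definition has_minimum (R : realType) (S : set R) : Prop :=
  exists2 v : R, S v & lbound S v.

(* The infimum; it is the minimum of [S] exactly when [has_minimum S], and is
   only meaningful as a minimum in that case. *)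
Definition minimum (R : realType) (S : set R) : R := inf S.

Definition lp_feasible (R : realType) (m n : nat) (A D : 'M[R]_(m, n))
    (b : 'cV[R]_m) (lambda : R) : set 'cV[R]_n :=
  [set x | cvle ((A + lambda *: D) *m x) b /\ cvle 0 x].

Definition lp_values (R : realType) (m n : nat) (A D : 'M[R]_(m, n))
    (b : 'cV[R]_m) (c : 'cV[R]_n) (lambda : R) : set R :=
  [set dotp c x | x in lp_feasible A D b lambda].

Definition lp_opt (R : realType) (m n : nat) (A D : 'M[R]_(m, n))
    (b : 'cV[R]_m) (c : 'cV[R]_n) (lambda : R) : R :=
  minimum (lp_values A D b c lambda).

Definition eps_feasible (R : realType) (m n : nat) (A D : 'M[R]_(m, n))
    (b : 'cV[R]_m) (c : 'cV[R]_n) (eps lambda : R) : set 'cV[R]_n :=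
  [set x | dotp c x <= lp_opt A D b c lambda + eps /\
           lp_feasible A D b lambda x].

Definition eps_values (R : realType) (m n : nat) (A D : 'M[R]_(m, n))
    (b : 'cV[R]_m) (c phi : 'cV[R]_n) (eps lambda : R) : set R :=
  [set dotp phi x | x in eps_feasible A D b c eps lambda].

Definition eps_opt (R : realType) (m n : nat) (A D : 'M[R]_(m, n))
    (b : 'cV[R]_m) (c phi : 'cV[R]_n) (eps lambda : R) : R :=
  minimum (eps_values A D b c phi eps lambda).

(* Main.v *)
Require Import Defs.
From HB Require Import structures.
From mathcomp Require Import all_boot all_order all_algebra.
From mathcomp Require Import all_classical all_reals all_analysis.

Set Implicit Arguments.
Unset Strict Implicit.
Unset Printing Implicit Defensive.

Import Order.TTheory GRing.Theory Num.Theory.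
Import numFieldNormedType.Exports.

Local Open Scope classical_set_scope.
Local Open Scope ring_scope.

(** One variable and one constraint suffice: minimise [x] subject to
    [lambda x <= 0] and [x >= 0], for [lambda] in [[0, 1]].  The optimal value
    is [0] for every [lambda], attained at [x = 0], so relaxing optimality by
    [eps] adds the constraint [x <= eps].  For [lambda > 0] the constraint
    [lambda x <= 0] forces [x = 0], whereas at [lambda = 0] it is vacuous and
    [x] ranges over all of [[0, eps]].  With the second objective [- x], the
    relaxed minimum is therefore [- eps] at [0] and [0] on the rest of the
    interval ([eps_opt_at0], [eps_opt_pos]): it jumps at [0]. *)

Lemma minimum_eq (R : realType) (S : set R) (v : R) :
  S v -> lbound S v -> minimum S = v.
Proof.
move=> Sv lbv; apply/eqP; rewrite eq_le; apply/andP; split.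
  by apply: ge_inf => //; exists v.
by apply: lb_le_inf => //; exists v.
Qed.

Section JumpProgram.
Variable R : realType.
Implicit Types (lambda eps t : R) (x : 'cV[R]_1).

Local Notation feasible := (@lp_feasible R 1 1 0 1%:M 0).
Local Notation values := (@lp_values R 1 1 0 1%:M 0 1%:M).
Local Notation opt := (@lp_opt R 1 1 0 1%:M 0 1%:M).
Local Notation relaxed_values := (@eps_values R 1 1 0 1%:M 0 1%:M (- 1%:M)).
Local Notation relaxed_opt := (@eps_opt R 1 1 0 1%:M 0 1%:M (- 1%:M)).

Lemma feasibleE lambda x :
  feasible lambda x <-> lambda * x 0 0 <= 0 /\ 0 <= x 0 0.
Proof.
rewrite /lp_feasible /= /cvle add0r -scalemxAl mul1mx; split.
  by move=> [/(_ 0) + /(_ 0)]; rewrite !mxE.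
by move=> [h1 h2]; split=> i; rewrite ord1 !mxE.
Qed.

Lemma dotp1 x : dotp 1%:M x = x 0 0.
Proof. by rewrite /dotp trmx1 mul1mx. Qed.

Lemma dotpN1 x : dotp (- 1%:M) x = - x 0 0.
Proof. by rewrite /dotp linearN /= trmx1 mulNmx mul1mx mxE. Qed.

Lemma feasible_origin lambda : feasible lambda 0.
Proof. by apply/feasibleE; rewrite mxE mulr0. Qed.

Lemma values0 lambda : values lambda 0.
Proof.
by exists 0; [exact: feasible_origin | rewrite dotp1 mxE].
Qed.

Lemma values_ge0 lambda : lbound (values lambda) 0.
Proof. by move=> _ [x /feasibleE[_ x0] <-]; rewrite dotp1. Qed.

Lemma opt0 lambda : opt lambda = 0.
Proof. exact: minimum_eq (values0 lambda) (@values_ge0 lambda). Qed.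

(** The optimum being [0], the relaxed bound on the first objective reads
    [x <= eps]; it is what keeps the second objective [- x] bounded below at
    [lambda = 0]. *)
Lemma relaxed_valuesP eps lambda t :
  relaxed_values eps lambda (- t) <->
  [/\ t <= eps, lambda * t <= 0 & 0 <= t].
Proof.
split.
  move=> [x [+ /feasibleE]]; rewrite opt0 add0r dotp1 dotpN1.
  by move=> xe [lx x0] /oppr_inj <-.
move=> [te lt t0]; exists (const_mx t); last by rewrite dotpN1 mxE.
by split; [rewrite opt0 add0r dotp1 mxE | apply/feasibleE; rewrite mxE].
Qed.

Lemma relaxed_values_min_at0 eps : 0 <= eps ->
  relaxed_values eps 0 (- eps) /\ lbound (relaxed_values eps 0) (- eps).
Proof.
move=> eps0; split; first by apply/relaxed_valuesP; rewrite mul0r.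
move=> v; rewrite -(opprK v) => /relaxed_valuesP[ve _ _].
by rewrite lerN2.
Qed.

Lemma relaxed_values_min_pos eps lambda : 0 <= eps -> 0 < lambda ->
  relaxed_values eps lambda 0 /\ lbound (relaxed_values eps lambda) 0.
Proof.
move=> eps0 l0; split.
  by have := (relaxed_valuesP eps lambda 0).2; rewrite oppr0 mulr0; apply.
move=> v; rewrite -{1}(opprK v) => /relaxed_valuesP[_ + _].
by rewrite pmulr_rle0// oppr_le0.
Qed.

Lemma eps_opt_at0 eps : 0 <= eps -> relaxed_opt eps 0 = - eps.
Proof. by move=> /relaxed_values_min_at0[]; exact: minimum_eq. Qed.

Lemma eps_opt_pos eps lambda : 0 <= eps -> 0 < lambda ->
  relaxed_opt eps lambda = 0.
Proof. by move=> e0 /(relaxed_values_min_pos e0)[]; exact: minimum_eq. Qed.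

(** Only the right limit at [0] is involved: the function is constantly [0]
    there, while its value at the endpoint is [- eps]. *)
Lemma eps_opt_discontinuous eps : 0 < eps ->
  ~ {within `[0, 1], continuous (relaxed_opt eps)}.
Proof.
move=> eps0 /(continuous_within_itvP _ ltr01)[_ + _].
rewrite eps_opt_at0 ?ltW// => cvgNeps.
have cvg0 : relaxed_opt eps x @[x --> 0^'+] --> (0 : R).
  apply: cvg_near_cst; near=> x.
  by rewrite eps_opt_pos// ltW.
have /eqP : - eps = 0 by exact: (cvg_unique (@norm_hausdorff _ _) cvgNeps cvg0).
by rewrite oppr_eq0 gt_eqF.
Unshelve. all: by end_near. Qed.

End JumpProgram.

Theorem mainTheorem6 (R : realType) (eps : R) (eps_gt0 : 0 < eps) :
  exists (m n : nat) (A D : 'M[R]_(m, n)) (b : 'cV[R]_m)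
    (c phi : 'cV[R]_n) (Lambda : interval R),
  [/\ (1 <= m)%N /\ (1 <= n)%N,
      forall lambda : R, lambda \in Lambda ->
        lp_feasible A D b lambda !=set0 /\
        has_minimum (lp_values A D b c lambda),
      forall lambda : R, lambda \in Lambda ->
        has_minimum (eps_values A D b c phi eps lambda) &
      ~ {within [set` Lambda], continuous (eps_opt A D b c phi eps)}].
Proof.
exists 1, 1, 0, 1%:M, 0, 1%:M, (- 1%:M), `[0, 1].
split=> // [lambda _|lambda|].
- split; first by exists 0; exact: feasible_origin.
  by exists 0; [exact: values0 | exact: values_ge0].
- rewrite in_itv /= => /andP[]; rewrite le_eqVlt => /predU1P[<-|l0] _.
    by have [] := relaxed_values_min_at0 (ltW eps_gt0); exists (- eps).
  by have [] := relaxed_values_min_pos (ltW eps_gt0) l0; exists 0.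
- exact: eps_opt_discontinuous.
Qed.
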